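(* Let $f\in\mathcal{C}(\Omega)$ be nonzero, let $\lambda\geq0$ and $\mu_1,\ldots,\mu_d>0$, and let $\bm{\beta}\in\mathbb{R}^d$ be a solution to $$\min_{\bm{\beta}\in\mathbb{R}^d}\ \frac12\|\mathbf{W}^{1/2}(\mathbf{A}\bm{\beta}-\mathbf{f})\|_2^2+\lambda\|\mathbf{R}\bm{\beta}\|_1.$$ 1) If $\lambda=0$, then $\|\bm{\beta}\|_0=\|\bm{\alpha}\|_0=\|\mathbf{A}^{\mathrm{T}}\mathbf{W}\mathbf{f}\|_0$. 2) If $\lambda>0$, then $\|\bm{\beta}\|_0\leq\|\mathbf{A}^{\mathrm{T}}\mathbf{W}\mathbf{f}\|_0$; more precisely, $$\|\bm{\beta}\|_0=\|\mathbf{A}^{\mathrm{T}}\mathbf{W}\mathbf{f}\|_0-\#\left\{\ell:|\langle f,p_\ell\rangle_N|\leq\lambda\mu_\ell\text{ and }\langle f,p_\ell\rangle_N\neq0\right\},$$ where $\#\{\cdot\}$ denotes the cardinality of the set.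
   Context: $\Omega\subset\mathbb{R}^s$ is a compact smooth Riemannian manifold with smooth or empty boundary, equipped with a positive measure $\mathrm{d}\omega$ of finite total mass $V=\int_\Omega\mathrm{d}\omega<\infty$. $\mathcal{C}(\Omega)$ is the space of continuous real functions on $\Omega$. $\mathbb{P}_L$ is the linear space of polynomials on $\Omega$ of degree at most $L$, $d=\dim\mathbb{P}_L$, and $\{p_1,\ldots,p_d\}$ is an orthonormal basis of $\mathbb{P}_L$ with respect to $\langle v,z\rangle=\int_\Omega vz\,\mathrm{d}\omega$. The distinct points $\mathbf{x}_1,\ldots,\mathbf{x}_N\in\Omega$ and weights $w_1,\ldots,w_N>0$ form a quadrature rule with exactness $\sum_{j=1}^N w_jg(\mathbf{x}_j)=\int_\Omega g\,\mathrm{d}\omega$ for all $g\in\mathbb{P}_{2L}$, and $\langle v,z\rangle_N=\sum_{j=1}^N w_jv(\mathbf{x}_j)z(\mathbf{x}_j)$. $\mathbf{A}\in\mathbb{R}^{N\times d}$ has entries $[\mathbf{A}]_{j\ell}=p_\ell(\mathbf{x}_j)$, $\mathbf{W}=\mathrm{diag}(w_1,\ldots,w_N)$, $\mathbf{R}=\mathrm{diag}(\mu_1,\ldots,\mu_d)$, $\mathbf{f}=[f(\mathbf{x}_1),\ldots,f(\mathbf{x}_N)]^{\mathrm{T}}$. $\bm{\alpha}\in\mathbb{R}^d$ is the solution of the unregularized problem $\min_{\bm{\alpha}\in\mathbb{R}^d}\frac12\|\mathbf{W}^{1/2}(\mathbf{A}\bm{\alpha}-\mathbf{f})\|_2^2$,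 i.e. the vector of hyperinterpolation coefficients $\alpha_\ell=\langle f,p_\ell\rangle_N$. $\|\cdot\|_0$ denotes the number of nonzero entries of a vector. *)

(* Defs.v *)
From HB Require Import structures.
From mathcomp Require Import all_boot all_order all_algebra.
From mathcomp Require Import all_classical all_reals all_analysis.
From mathcomp Require mpoly.
Import -(notations) mpoly.

Set Implicit Arguments.
Unset Strict Implicit.
Unset Printing Implicit Defensive.

Import Order.TTheory GRing.Theory Num.Theory.
Import numFieldNormedType.Exports.

Local Open Scope classical_set_scope.
Local Open Scope ring_scope.

(* C^oo on an open set U: every iterated directional derivative of f exists
   and is continuous at every point of U. *)
Definition iter_derive (R : realType) (V W : normedModType R)
    (vs : seq V) (f : V -> W) : V -> W :=
  foldr (fun v g => (fun x => 'D_v g x)) f vs.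

Definition smooth_on (R : realType) (V W : normedModType R)
    (U : set V) (f : V -> W) : Prop :=
  forall (vs : seq V) (x : V), U x ->
    {for x, continuous (iter_derive vs f)} /\
    forall v : V, derivable (iter_derive vs f) x v.

(* The half-space {y_0 >= 0, y_m = ... = y_(s-1) = 0} of R^m x {0} in R^s
   (reduced to the origin when m = 0). It is the local model both at interior
   points, whose charts may be taken with values in {y_0 > 0}, and at boundary
   points, so that the boundary may be empty. *)
Definition half_space (R : realType) (s m : nat) : set 'rV[R]_s :=
  [set y | forall i : 'I_s,
     ((i : nat) = 0%N -> 0 <= y 0 i) /\ ((m <= i)%N -> y 0 i = 0)].

(* phi is a diffeomorphism, with inverse psi, between open subsets U and
   phi(U) of R^s that maps the part of Omega in U onto the part of the
   half-space in phi(U). *)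
Record slice_chart (R : realType) (s m : nat) (Omega : set 'rV[R]_s)
    (U : set 'rV[R]_s) (phi psi : 'rV[R]_s -> 'rV[R]_s) : Prop := SliceChart {
  slice_open_dom : open U;
  slice_open_cod : open (phi @` U);
  slice_smooth : smooth_on U phi;
  slice_smooth_inv : smooth_on (phi @` U) psi;
  slice_cancel : {in U, cancel phi psi};
  slice_image : phi @` (U `&` Omega) = (phi @` U) `&` half_space m }.

Definition smooth_submanifold (R : realType) (s m : nat)
    (Omega : set 'rV[R]_s) : Prop :=
  (m <= s)%N /\
  forall x, Omega x -> exists (U : set 'rV[R]_s) (phi psi : 'rV[R]_s -> 'rV[R]_s),
    U x /\ slice_chart m Omega U phi psi.

Definition tangent (R : realType) (s m : nat) (Omega : set 'rV[R]_s)
    (x v : 'rV[R]_s) : Prop :=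
  exists (U : set 'rV[R]_s) (phi psi : 'rV[R]_s -> 'rV[R]_s),
    [/\ U x, slice_chart m Omega U phi psi &
        forall i : 'I_s, (m <= i)%N -> ('D_v phi x) 0 i = 0].

(* A Riemannian metric on Omega: the bilinear form on the tangent space at x is
   (u, v) |-> u *m g x *m v^T. Only the restriction of g x to tangent vectors is
   constrained; g is smooth on Omega in the sense that it has local smooth
   extensions to open subsets of R^s. *)
Record riemannian_metric (R : realType) (s m : nat) (Omega : set 'rV[R]_s)
    (g : 'rV[R]_s -> 'M[R]_s) : Prop := RiemannianMetric {
  metric_smooth : forall x, Omega x ->
    exists (U : set 'rV[R]_s) (G : 'rV[R]_s -> 'M[R]_s),
      [/\ open U, U x, smooth_on U G &
          forall y, U y -> Omega y -> G y = g y];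
  metric_sym : forall x u v, Omega x ->
    tangent m Omega x u -> tangent m Omega x v ->
    u *m g x *m v^T = v *m g x *m u^T;
  metric_pos : forall x v, Omega x -> tangent m Omega x v -> v != 0 ->
    0 < (v *m g x *m v^T) 0 0 }.

Notation borel_rV R s := (g_sigma_algebraType (@open 'rV[R]_s)).

(* P_L(Omega), as functions on R^s that agree on Omega with a polynomial of
   total degree at most L; their values outside Omega are irrelevant.
   mpoly.msize q is the total degree of q plus one, and 0 for q = 0. *)
Definition poly_space (R : realType) (s : nat) (Omega : set 'rV[R]_s) (L : nat) :
    set ('rV[R]_s -> R) :=
  [set g | exists2 q : mpoly.mpoly s R, (mpoly.msize q <= L.+1)%N &
     forall x, Omega x -> g x = mpoly.meval (fun i => x 0 i) q].
Arguments poly_space {R s} Omega L.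

Definition inner (R : realType) (s : nat)
    (mu : {measure set (borel_rV R s) -> \bar R}) (Omega : set 'rV[R]_s)
    (v z : 'rV[R]_s -> R) : R :=
  \int[mu]_(y in (Omega : set (borel_rV R s))) (v y * z y).

(* Since p is a basis with d elements, d is the dimension of P_L(Omega). *)
Record orthonormal_basis (R : realType) (s : nat)
    (mu : {measure set (borel_rV R s) -> \bar R}) (Omega : set 'rV[R]_s)
    (L d : nat) (p : 'I_d -> 'rV[R]_s -> R) : Prop := OrthonormalBasis {
  basis_mem : forall l, poly_space Omega L (p l);
  basis_free : forall c : 'I_d -> R,
    (forall x, Omega x -> \sum_l c l * p l x = 0) -> forall l, c l = 0;
  basis_span : forall g, poly_space Omega L g ->
    exists c : 'I_d -> R, forall x, Omega x -> g x = \sum_l c l * p l x;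
  basis_orthonormal : forall k l,
    inner mu Omega (p k) (p l) = (k == l)%:R }.

Record quadrature_rule (R : realType) (s : nat)
    (mu : {measure set (borel_rV R s) -> \bar R}) (Omega : set 'rV[R]_s)
    (K N : nat) (x : 'I_N -> 'rV[R]_s) (w : 'I_N -> R) : Prop :=
  QuadratureRule {
  quad_mem : forall j, Omega (x j);
  quad_distinct : injective x;
  quad_pos : forall j, 0 < w j;
  quad_exact : forall g, poly_space Omega K g ->
    \sum_j w j * g (x j) = \int[mu]_(y in (Omega : set (borel_rV R s))) g y }.

Definition inner_quad (R : realType) (s N : nat)
    (x : 'I_N -> 'rV[R]_s) (w : 'I_N -> R) (v z : 'rV[R]_s -> R) : R :=
  \sum_j w j * v (x j) * z (x j).

Definition sampling_mx (R : realType) (s N d : nat)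
    (p : 'I_d -> 'rV[R]_s -> R) (x : 'I_N -> 'rV[R]_s) : 'M[R]_(N, d) :=
  \matrix_(j < N, l < d) p l (x j).

Definition sample_vec (R : realType) (s N : nat)
    (f : 'rV[R]_s -> R) (x : 'I_N -> 'rV[R]_s) : 'cV[R]_N :=
  \col_j f (x j).

Definition diag_of (R : realType) (n : nat) (a : 'I_n -> R) : 'M[R]_n :=
  diag_mx (\row_i a i).

Definition norm0 (R : realType) (n : nat) (v : 'cV[R]_n) : nat :=
  #|[set i | v i 0 != 0]%SET|.

Definition norm1 (R : realType) (n : nat) (v : 'cV[R]_n) : R :=
  \sum_i `|v i 0|.

(* The norm `|v| of the library on 'cV[R]_n is the sup norm. *)
Definition norm2 (R : realType) (n : nat) (v : 'cV[R]_n) : R :=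
  Num.sqrt (\sum_i v i 0 ^+ 2).

Definition least_squares (R : realType) (N d : nat) (w : 'I_N -> R)
    (A : 'M[R]_(N, d)) (b : 'cV[R]_N) (c : 'cV[R]_d) : R :=
  2^-1 * norm2 (diag_of (fun j => Num.sqrt (w j)) *m (A *m c - b)) ^+ 2.

Definition lasso (R : realType) (N d : nat) (w : 'I_N -> R)
    (A : 'M[R]_(N, d)) (b : 'cV[R]_N) (lambda : R) (r : 'I_d -> R)
    (c : 'cV[R]_d) : R :=
  least_squares w A b c + lambda * norm1 (diag_of r *m c).

Definition minimizes (R : realType) (T : Type) (F : T -> R) (c : T) : Prop :=
  forall c', F c <= F c'.

(* Main.v *)
Require Import Defs.
From HB Require Import structures.
From mathcomp Require Import all_boot all_order all_algebra.
From mathcomp Require Import all_classical all_reals all_analysis.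
From mathcomp Require Import ring lra.
From mathcomp Require mpoly.
Import -(notations) mpoly.

(** The [l1]-regularized problem decouples into [d] scalar problems, because
    sampling an orthonormal basis at the nodes of a quadrature rule that is
    exact in degree [2L] keeps it orthonormal: a product of two elements of
    [P_L] lies in [P_(2L)], so [A^T W A = 1] ([gram_sampling_mx]).  Put
    [b = A^T W f], whose entries are the hyperinterpolation coefficients
    [<f, p_l>_N].  Expanding the square, the objective equals, up to a constant,
    the sum over [l] of [t^2/2 - b_l t + lambda mu_l |t|] at [t = beta_l]
    ([lasso_orthonormal]), and a minimizer of a separable sum minimizes every
    term ([minimizes_sum]).

    The minimizer of [t^2/2 - b t + k |t|] is the soft thresholding of [b] at
    level [k]; all that matters here is that it vanishes exactly when
    [|b| <= k] ([scalar_lasso_eq0]).  Hence the support of [beta] is the set of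
    [l] with [|b_l| > lambda mu_l], and both claims follow by counting: for
    [lambda = 0] this set is the support of [b], and the unregularized problem
    is the same problem with [lambda = 0]; for [lambda > 0] it is the support
    of [b] with the indices [l] such that [0 < |b_l| <= lambda mu_l] removed. *)

Set Implicit Arguments.
Unset Strict Implicit.
Unset Printing Implicit Defensive.

Import Order.TTheory GRing.Theory Num.Theory.
Import numFieldNormedType.Exports.

Local Open Scope classical_set_scope.
Local Open Scope ring_scope.

(** This is [(t - b)^2 / 2 + k |t|] up to the constant [b^2 / 2]; without it,
    expanding the vector objective gives the summands on the nose. *)
Definition scalar_lasso (R : realType) (b k t : R) : R :=
  2^-1 * t ^+ 2 - b * t + k * `|t|.

(** Both directions compare the minimizer [t] with one competitor.  The
    competitor [0] gives [t^2/2 <= b t - k |t| <= 0] when [|b| <= k].  When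
    [|b| > k], the soft thresholding of [b] has a negative value, so that the
    minimizer is not [0]. *)
Lemma scalar_lasso_eq0 (R : realType) (b k t : R) : 0 <= k ->
  minimizes (scalar_lasso b k) t -> (t == 0) = (`|b| <= k).
Proof.
move=> k_ge0 t_min; apply/eqP/idP => [t0|b_le].
  rewrite leNgt; apply/negP => k_lt.
  (* The soft thresholding of [b], with value [- (|b| - k)^2 / 2]. *)
  have := t_min (Num.sg b * (`|b| - k)).
  have b_neq0 : b != 0 by rewrite -normr_gt0 (le_lt_trans k_ge0).
  have bsg : b * Num.sg b = `|b| by rewrite mulrC -normrEsg.
  rewrite /scalar_lasso t0 normr0 normrM normr_sg b_neq0 mul1r.
  rewrite (ger0_norm (ltW _)) ?subr_gt0// exprMn sqr_sg b_neq0 mul1r (mulrA b) bsg.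
  move: (`|b|) k_lt => a k_lt; nra.
have := t_min 0; rewrite /scalar_lasso normr0.
have bt_le : b * t <= k * `|t|.
  by rewrite (le_trans (ler_norm _))// normrM ler_wpM2r.
move=> ht; apply/eqP; rewrite -sqrf_eq0; apply/eqP/le_anti.
by rewrite sqr_ge0 andbT; lra.
Qed.

Lemma minimizes_sum (R : realType) (d : nat) (h : 'I_d -> R -> R)
    (c : 'cV[R]_d) :
  minimizes (fun c' : 'cV[R]_d => \sum_l h l (c' l 0)) c ->
  forall l, minimizes (h l) (c l 0).
Proof.
move=> c_min l t.
have := c_min (\col_i if i == l then t else c i 0).
rewrite (bigD1 l)//= [leRHS](bigD1 l)//= mxE eqxx.
rewrite [X in _ <= _ + X](eq_bigr (fun i => h i (c i 0))) ?lerD2r//.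
by move=> i /negPf il; rewrite mxE il.
Qed.

Lemma diag_formE (R : realType) (n : nat) (w : 'I_n -> R) (u v : 'cV[R]_n) :
  (u^T *m diag_of w *m v) 0 0 = \sum_j w j * (u j 0 * v j 0).
Proof.
rewrite mxE; apply: eq_bigr => j _.
by rewrite /diag_of mul_mx_diag !mxE mulrA [u j 0 * _]mulrC.
Qed.

Lemma least_squaresE (R : realType) (N d : nat) (w : 'I_N -> R)
    (A : 'M[R]_(N, d)) (b : 'cV[R]_N) (c : 'cV[R]_d) :
  (forall j, 0 <= w j) ->
  least_squares w A b c =
  2^-1 * ((A *m c - b)^T *m diag_of w *m (A *m c - b)) 0 0.
Proof.
move=> w_ge0; rewrite /least_squares /norm2 sqr_sqrtr; last first.
  by apply: sumr_ge0 => j _; exact: sqr_ge0.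
rewrite diag_formE; congr (_ * _); apply: eq_bigr => j _.
by rewrite /diag_of mul_diag_mx mxE [X in X * _]mxE exprMn sqr_sqrtr.
Qed.

(** Orthonormality of the columns of [A] turns the quadratic part
    [(A c)^T W (A c)] into [|c|^2], which removes the only coupling between the
    coordinates of [c]. *)
Lemma lasso_orthonormal (R : realType) (N d : nat) (w : 'I_N -> R)
    (A : 'M[R]_(N, d)) (b : 'cV[R]_N) (lambda : R) (r : 'I_d -> R)
    (c : 'cV[R]_d) :
  (forall j, 0 <= w j) -> (forall l, 0 <= r l) ->
  A^T *m diag_of w *m A = 1%:M ->
  lasso w A b lambda r c = 2^-1 * (b^T *m diag_of w *m b) 0 0 +
    \sum_l scalar_lasso ((A^T *m diag_of w *m b) l 0) (lambda * r l) (c l 0).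
Proof.
move=> w_ge0 r_ge0 gramA; rewrite /lasso least_squaresE//.
set W := diag_of w.
have quad : ((A *m c)^T *m W *m (A *m c)) 0 0 = \sum_l c l 0 ^+ 2.
  rewrite trmx_mul mulmxA -(mulmxA c^T) -(mulmxA c^T) gramA mulmx1 mxE.
  by apply: eq_bigr => l _; rewrite mxE expr2.
have cross : ((A *m c)^T *m W *m b) 0 0 =
    \sum_l (A^T *m W *m b) l 0 * c l 0.
  rewrite trmx_mul -!mulmxA mxE.
  by apply: eq_bigr => l _; rewrite mxE mulrC.
have -> : ((A *m c - b)^T *m W *m (A *m c - b)) 0 0 =
    ((A *m c)^T *m W *m (A *m c)) 0 0 - 2 * ((A *m c)^T *m W *m b) 0 0
    + (b^T *m W *m b) 0 0.
  rewrite !diag_formE mulr_sumr -sumrB -big_split/=; apply: eq_bigr => j _.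
  by rewrite [(A *m c - b) j 0]mxE [(- b) j 0]mxE; ring.
rewrite quad cross /norm1 !mulrDr mulr_sumr.
have -> : lambda * (\sum_l `|(diag_of r *m c) l 0|) =
    \sum_l lambda * r l * `|c l 0|.
  rewrite mulr_sumr; apply: eq_bigr => l _.
  by rewrite /diag_of mul_diag_mx !mxE normrM ger0_norm// mulrA.
rewrite /scalar_lasso !big_split/= sumrN -mulr_sumr.
rewrite -!mulr_sumr.
by field.
Qed.

Lemma poly_space_mul (R : realType) (s : nat) (Omega : set 'rV[R]_s)
    (K L : nat) (g h : 'rV[R]_s -> R) :
  poly_space Omega K g -> poly_space Omega L h ->
  poly_space Omega (K + L)%N (fun y => g y * h y).
Proof.
move=> [q qK gq] [q' q'L hq']; exists (q * q'); last first.
  by move=> y Oy; rewrite gq// hq'// mevalM.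
(* Degrees add up only for nonzero polynomials, as [msize 0 = 0]. *)
have [->|q0] := eqVneq q 0; first by rewrite mul0r msize0.
have [->|q'0] := eqVneq q' 0; first by rewrite mulr0 msize0.
rewrite msizeM//.
by rewrite -subn1 leq_subLR add1n -addSn -addnS leq_add.
Qed.

(** The Gram matrix of the columns for the weighted discrete inner product is
    the one for the integral, since the quadrature is exact on products. *)
Lemma gram_sampling_mx (R : realType) (s : nat)
    (mu : {measure set (borel_rV R s) -> \bar R}) (Omega : set 'rV[R]_s)
    (L d N : nat) (p : 'I_d -> 'rV[R]_s -> R)
    (x : 'I_N -> 'rV[R]_s) (w : 'I_N -> R) :
  orthonormal_basis mu Omega L p -> quadrature_rule mu Omega (2 * L) x w ->
  (sampling_mx p x)^T *m diag_of w *m sampling_mx p x = 1%:M.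
Proof.
move=> p_basis xw; apply/matrixP => k l.
have pkl : poly_space Omega (2 * L) (fun y => p k y * p l y).
  by rewrite mul2n -addnn; apply: poly_space_mul; exact: Defs.basis_mem p_basis _.
rewrite [RHS]mxE -(basis_orthonormal p_basis) /inner -(quad_exact xw pkl) mxE.
apply: eq_bigr => j _.
by rewrite /diag_of mul_mx_diag !mxE mulrA [p k _ * _]mulrC.
Qed.

Lemma sampling_mx_coef (R : realType) (s d N : nat)
    (p : 'I_d -> 'rV[R]_s -> R) (x : 'I_N -> 'rV[R]_s) (w : 'I_N -> R)
    (f : 'rV[R]_s -> R) (l : 'I_d) :
  ((sampling_mx p x)^T *m diag_of w *m sample_vec f x) l 0 =
  inner_quad x w f (p l).
Proof.
rewrite mxE; apply: eq_bigr => j _.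
by rewrite /diag_of mul_mx_diag !mxE [p l _ * _]mulrC mulrAC.
Qed.

(** The case [lambda = 0] is included, so that one statement serves the
    regularized and the unregularized problem. *)
Lemma lasso_minimizer_eq0 (R : realType) (N d : nat) (w : 'I_N -> R)
    (A : 'M[R]_(N, d)) (b : 'cV[R]_N) (lambda : R) (r : 'I_d -> R)
    (c : 'cV[R]_d) (l : 'I_d) :
  (forall j, 0 <= w j) -> (forall l, 0 <= r l) -> 0 <= lambda ->
  A^T *m diag_of w *m A = 1%:M -> minimizes (lasso w A b lambda r) c ->
  (c l 0 == 0) = (`|(A^T *m diag_of w *m b) l 0| <= lambda * r l).
Proof.
move=> w_ge0 r_ge0 lambda_ge0 gramA c_min.
apply: scalar_lasso_eq0; first exact: mulr_ge0.
pose h l := scalar_lasso ((A^T *m diag_of w *m b) l 0) (lambda * r l).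
apply: (@minimizes_sum _ _ h) => c'.
by have := c_min c'; rewrite !lasso_orthonormal// lerD2l.
Qed.

Theorem theorem3p10 (R : realType) (s m : nat)
    (Omega : set 'rV[R]_s) (metric : 'rV[R]_s -> 'M[R]_s)
    (mu : {measure set (borel_rV R s) -> \bar R})
    (L d N : nat) (p : 'I_d -> 'rV[R]_s -> R)
    (x : 'I_N -> 'rV[R]_s) (w : 'I_N -> R)
    (f : 'rV[R]_s -> R) (lambda : R) (r : 'I_d -> R)
    (alpha beta : 'cV[R]_d)
    (Omega_compact : compact Omega)
    (Omega_manifold : smooth_submanifold m Omega)
    (Omega_metric : riemannian_metric m Omega metric)
    (mu_finite : (mu Omega < +oo)%E)
    (p_basis : orthonormal_basis mu Omega L p)
    (xw_quadrature : quadrature_rule mu Omega (2 * L) x w)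
    (f_continuous : {within Omega, continuous f})
    (f_nonzero : exists2 y, Omega y & f y != 0)
    (lambda_ge0 : 0 <= lambda)
    (r_gt0 : forall l, 0 < r l) :
  let A := sampling_mx p x in
  let W := diag_of w in
  let fv := sample_vec f x in
  minimizes (least_squares w A fv) alpha ->
  minimizes (lasso w A fv lambda r) beta ->
  (lambda = 0 ->
     norm0 beta = norm0 alpha /\ norm0 alpha = norm0 (A^T *m W *m fv)) /\
  (0 < lambda ->
     (norm0 beta <= norm0 (A^T *m W *m fv))%N /\
     (norm0 beta)%:Z =
       (norm0 (A^T *m W *m fv))%:Z -
       #|[set l | (`|inner_quad x w f (p l)| <= lambda * r l) &&
                  (inner_quad x w f (p l) != 0)]%SET|%:Z).
Proof.
move=> A W fv alpha_min beta_min.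
have gramA : A^T *m diag_of w *m A = 1%:M :=
  gram_sampling_mx p_basis xw_quadrature.
have w_ge0 j : 0 <= w j := ltW (quad_pos xw_quadrature j).
have r_ge0 l : 0 <= r l := ltW (r_gt0 l).
have beta0 l := lasso_minimizer_eq0 l w_ge0 r_ge0 lambda_ge0 gramA beta_min.
have alpha_min0 : minimizes (lasso w A fv 0 r) alpha.
  by move=> c; rewrite /lasso !mul0r !addr0.
have alpha0 l := lasso_minimizer_eq0 l w_ge0 r_ge0 (lexx 0) gramA alpha_min0.
split=> [lambda0|lambda_gt0].
  split; rewrite /norm0; apply: eq_card => l; rewrite !inE.
    by rewrite beta0 alpha0 lambda0.
  by rewrite alpha0 mul0r normr_le0.
pose B := [set l | (A^T *m W *m fv) l 0 != 0]%SET.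
pose T := [set l | (`|inner_quad x w f (p l)| <= lambda * r l) &&
                  (inner_quad x w f (p l) != 0)]%SET.
have TB : T \subset B.
  by apply/fintype.subsetP => l; rewrite !inE sampling_mx_coef => /andP[].
have betaE : norm0 beta = #|B :\: T|%SET.
  rewrite /norm0; apply: eq_card => l; rewrite !inE beta0 sampling_mx_coef.
  have [->|b0] := eqVneq (inner_quad x w f (p l)) 0; last by rewrite !andbT.
  by rewrite normr0 mulr_ge0// andbF.
rewrite betaE cardsD (finset.setIidPr TB) leq_subr; split=> //.
by rewrite -subzn// subset_leq_card.
Qed.
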